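(* Let $\Omega\subset\mathbb{R}^d$ be a smooth bounded domain and assume $\eta\equiv\kappa$. Let $a,b,c\in\mathbb{R}$ with $c\le2b$. If $(v,w)$, $w\ge0$, is a classical solution on $[0,T]\times\Omega$ of $$\dot v=\operatorname{div}(\eta(w)\nabla v),\qquad \dot w=\operatorname{div}(\kappa(w)\nabla w)+\eta(w)|\nabla v|^2,\qquad \eta(w)\nabla v\cdot\mathrm n=0=\kappa(w)\nabla w\cdot\mathrm n\ \text{ on }\partial\Omega,$$ with initial data $v(0,\cdot)=v^0$, $w(0,\cdot)=w^0$, then $$a v^0+b(v^0)^2+c w^0\le0\ \text{ on }\Omega\quad\Longrightarrow\quad a v+b v^2+c w\le0\ \text{ on }[0,T]\times\Omega.$$ In particular, for $M_*\ge0$, the estimate $|v^0|\le M_*w^0$ on $\Omega$ implies $|v(t,x)|\le M_*w(t,x)$ for all $(t,x)\in[0,T]\times\Omega$.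
   Context: $\eta=\kappa:[0,\infty[\to[0,\infty[$ is the given coefficient function (with prototype $\eta(w)=\eta_0w^\alpha$, $\eta_0,\alpha>0$). Classical solutions are smooth solutions, regular up to the boundary and up to $t=0$; $\mathrm n$ is the outer unit normal. *)

(* Defs.v *)
From HB Require Import structures.
From mathcomp Require Import all_boot all_order all_algebra.
From mathcomp Require Import all_classical all_reals all_analysis.

Set Implicit Arguments.
Unset Strict Implicit.
Unset Printing Implicit Defensive.

Import Order.TTheory GRing.Theory Num.Theory.
Import numFieldNormedType.Exports.

Local Open Scope classical_set_scope.
Local Open Scope ring_scope.

Section Regularity.
Context {R : realType} {V : normedModType R}.
Implicit Types (U A : set V) (f : V -> R).

(* 'D_v1 ('D_v2 ( ... f)) for vs = [:: v1; v2; ...] *)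
Definition iter_derive f (vs : seq V) : V -> R :=
  foldr (fun v (g : V -> R) => 'D_v g) f vs.

(* Meant for U open.  All directions are allowed, not only the coordinate
   ones; in finite dimension this is the usual class C^k. *)
Definition Ck_on (k : nat) U f : Prop :=
  forall vs : seq V, (size vs <= k)%N ->
    (forall x, U x -> {for x, continuous (iter_derive f vs)}) /\
    ((size vs < k)%N ->
      forall x v, U x -> derivable (iter_derive f vs) x v).

Definition smooth_on U f : Prop := forall k, Ck_on k U f.

(* The function itself is smooth on a neighbourhood of A, so that its two-sided
   derivatives make sense at every point of A, boundary points included. *)
Definition smooth_near A f : Prop :=
  exists U, [/\ open U, A `<=` U & smooth_on U f].

(* Only the values of f on A matter here. *)
Definition Ck_upto (k : nat) A f : Prop :=
  exists g U, [/\ open U, A `<=` U, Ck_on k U g & {in A, f =1 g}].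

End Regularity.

Section VectorCalculus.
Context {R : realType} {d : nat}.
Local Notation E := 'rV[R]_d.

Definition basis_vec (i : 'I_d) : E := delta_mx 0 i.

Definition dot (x y : E) : R := \sum_i x 0 i * y 0 i.

(* The library norm on 'rV[R]_d is the sup norm. *)
Definition enorm (x : E) : R := Num.sqrt (dot x x).

Definition grad (f : E -> R) (x : E) : E := \row_i 'D_(basis_vec i) f x.

Definition div (F : E -> E) (x : E) : R :=
  \sum_i 'D_(basis_vec i) (fun y => F y 0 i) x.

End VectorCalculus.

Section SmoothDomain.
Context {R : realType} {d : nat}.
Local Notation E := 'rV[R]_d.
Implicit Types (Omega U : set E) (p n : E) (rho : E -> R).

Definition boundary Omega : set E := closure Omega `\` Omega°.

Definition local_defining_function Omega p U rho : Prop :=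
  [/\ open_nbhs p U, smooth_on U rho, forall x, U x -> grad rho x != 0
    & forall x, U x -> (Omega x <-> rho x < 0)].

Definition smooth_bounded_domain Omega : Prop :=
  [/\ open Omega, connected Omega, Omega !=set0, bounded_set Omega
    & forall p, boundary Omega p ->
        exists U rho, local_defining_function Omega p U rho].

Definition outer_unit_normal Omega p n : Prop :=
  exists U rho, local_defining_function Omega p U rho /\
    n = (enorm (grad rho p))^-1 *: grad rho p.

End SmoothDomain.

Section System.
Context {R : realType} {d : nat}.
Local Notation E := 'rV[R]_d.

Definition flux (mu : R -> R) (w u : R -> E -> R) (t : R) (x : E) : E :=
  mu (w t x) *: grad (u t) x.

(* The coefficients are only constrained on [0, +oo[ and w is only nonnegative
   on the closed cylinder, hence Ck_upto for the fluxes.  Their C^1 regularity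
   does not follow from that of v and w when, as for s |-> s `^ alpha with
   alpha < 1, the coefficients are not differentiable at 0. *)
Record classical_solution (eta kappa : R -> R) (T : R) (Omega : set E)
    (v w : R -> E -> R) (v0 w0 : E -> R) : Prop := ClassicalSolution {
  cs_smooth_v :
    smooth_near (`[0, T] `*` closure Omega) (fun z : R * E => v z.1 z.2) ;
  cs_smooth_w :
    smooth_near (`[0, T] `*` closure Omega) (fun z : R * E => w z.1 z.2) ;
  cs_flux_v : forall t, t \in `[0, T] -> forall i,
    Ck_upto 1 (closure Omega) (fun x => flux eta w v t x 0 i) ;
  cs_flux_w : forall t, t \in `[0, T] -> forall i,
    Ck_upto 1 (closure Omega) (fun x => flux kappa w w t x 0 i) ;
  cs_eq_v : forall t x, t \in `[0, T] -> Omega x ->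
    derive1 (v ^~ x) t = div (flux eta w v t) x ;
  cs_eq_w : forall t x, t \in `[0, T] -> Omega x ->
    derive1 (w ^~ x) t =
      div (flux kappa w w t) x + eta (w t x) * enorm (grad (v t) x) ^+ 2 ;
  cs_bc_v : forall t p n, t \in `[0, T] -> boundary Omega p ->
    outer_unit_normal Omega p n -> dot (flux eta w v t p) n = 0 ;
  cs_bc_w : forall t p n, t \in `[0, T] -> boundary Omega p ->
    outer_unit_normal Omega p n -> dot (flux kappa w w t p) n = 0 ;
  cs_init_v : forall x, Omega x -> v 0 x = v0 x ;
  cs_init_w : forall x, Omega x -> w 0 x = w0 x
}.

End System.

(* Main.v *)
Require Import Defs.
From mathcomp Require Import all_boot all_order all_algebra.
From mathcomp Require Import all_classical all_reals all_analysis.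
From mathcomp Require Import ring lra.
Import Order.TTheory GRing.Theory Num.Theory.
Import numFieldNormedType.Exports.
Local Open Scope classical_set_scope.
Local Open Scope ring_scope.

(** Put [u = a v + b v^2 + c w].  Since [eta = kappa] along the solution, the
    two equations combine to
      [u_t = div (eta(w) grad u) + (c - 2 b) eta(w) |grad v|^2],
    whose last term is nonpositive, and the flux [G = eta(w) grad u] has zero
    normal component on the boundary.  So the claim is a maximum principle for
    a degenerate parabolic inequality with no-flux boundary condition.

    It is proved pointwise, without integrating by parts.  If [u] were positive
    somewhere, [u - e t] with a small [e > 0] would have a positive maximum
    over the closed cylinder at some [(t, x)] with [t > 0], where [u_t >= e]
    ([le0_of_derive1_le0_at_max]).  It remains to see that [div G x <= 0]
    whenever [x] maximises [u t] over the closed domain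
    ([div_le0_at_max]).  Nothing is known about the regularity of [eta], which
    may vanish, so [eta] cannot be differentiated; only [G] can.  Three facts
    replace the usual second-derivative test.
    - [G x = 0]: if [eta(w) != 0] at [x], then [grad u] is orthogonal to the
      normal there and has nonpositive inner product with each inward
      direction, hence vanishes.
    - If [v] points into the domain, then the derivative at [x] of [G . v] in
      the direction [v] is nonpositive: otherwise [G . v], which equals
      [eta(w)] times the derivative of [u] along [v], would be positive on a
      short segment issued from [x], so [u] would increase along it
      ([derive_flux_le0_at_max]).
    - That derivative is a quadratic form in [v].  Nonpositive on an open
      half-space, it is nonpositive everywhere
      ([le0_quadratic_halfspace]), so its trace [div G x] is nonpositive.
    This treats interior and boundary points alike, the interior ones with zero
    for the normal and every direction inward; the shape of the
    boundary enters only through the inward segments of [smooth_domain_inward].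

    The equations hold in the open domain, and pass to its closure by
    continuity ([equations_on_closure]).  The source term is
    handled in the form [(eta(w) grad v) . grad v], which is continuous because
    the flux is, whereas [eta(w)] alone may not be. *)

(** * Continuously differentiable functions at a point *)

Section DirectionalDerivatives.
Context {R : realType} {V : normedModType R}.
Implicit Types (f g : V -> R) (x y v w : V).

(** The points reached from [x] by a step [h] along [v] and then a step at
    most [h] along [w]: where the mean value theorem is applied to compare
    increments of a function in the directions [v] and [v + w]. *)
Lemma near_right_cone (P : set V) x v w : nbhs x P ->
  \forall h \near 0^'+, forall s, 0 <= s <= h -> P (s *: w + (h *: v + x)).
Proof.
move=> /nbhs_normP[e /= e0 eP].
have c0 : 0 < `|w| + `|v| + 1 by rewrite ltr_wpDl ?addr_ge0.
near=> h => s /andP[s0 sh]; apply: eP => /=.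
have h0 : 0 < h by [].
rewrite addrA opprD addrCA subrr addr0 normrN.
apply: (@le_lt_trans _ _ (h * (`|w| + `|v| + 1))).
  rewrite !mulrDr mulr1 -[leLHS]addr0 lerD ?(ltW h0)//.
  rewrite (le_trans (ler_normD _ _))// !normrZ (ger0_norm s0) (gtr0_norm h0).
  by rewrite lerD2r ler_wpM2r.
rewrite -ltr_pdivlMr//; near: h; apply: nbhs_right_lt; exact: divr_gt0.
Unshelve. all: by end_near. Qed.

Lemma near_right_segment (P : set V) x v : nbhs x P ->
  \forall h \near 0^'+, forall s, 0 <= s <= h -> P (s *: v + x).
Proof.
move=> /(near_right_cone _ _ 0 v); apply: filterS => h Ph s sh.
by have := Ph s sh; rewrite scaler0 add0r.
Qed.

Lemma is_derive_line f x v (h : R) : derivable f (h *: v + x) v ->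
  is_derive h 1 (fun s => f (s *: v + x)) ('D_v f (h *: v + x)).
Proof.
move=> df.
have E : (fun k : R => k^-1 *: ((f \o shift (h *: v + x)) (k *: v)
            - f (h *: v + x))) =
         (fun k : R => k^-1 *: (((fun s => f (s *: v + x)) \o shift h) (k *: 1)
            - f (h *: v + x))).
  apply/funext => k /=; congr (_ *: (f _ - _)).
  by rewrite [k *: 1]mulr1 scalerDl addrA.
by split; rewrite /derivable /derive -E.
Qed.

Lemma MVT_line f x v (h : R) : 0 < h ->
  (forall s, 0 <= s <= h -> derivable f (s *: v + x) v) ->
  exists2 s, 0 < s < h & f (h *: v + x) - f x = 'D_v f (s *: v + x) * h.
Proof.
move=> h0 df.
have [||s] := @MVT R (fun s => f (s *: v + x))
    (fun s => 'D_v f (s *: v + x)) 0 h h0.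
- move=> s; rewrite in_itv/= => /andP[s0 sh].
  by apply/is_derive_line/df; rewrite !ltW.
- apply: derivable_within_continuous => s; rewrite in_itv/= => sh.
  by have [] := is_derive_line _ _ _ _ (df s sh).
- by rewrite in_itv/= scale0r add0r subr0 => sh E; exists s.
Qed.

Lemma derivable_cvg_right f x v : derivable f x v ->
  h^-1 *: (f (h *: v + x) - f x) @[h --> 0^'+] --> 'D_v f x.
Proof.
move=> df; apply: cvg_trans df; apply: cvg_app.
move=> A [e egt0 Ae]; exists e => // y xe ygt0; apply: Ae => //.
exact/lt0r_neq0.
Qed.

(** Existence and continuity of directional derivatives in every direction,
    which is what the mean value theorem needs to make them linear in the
    direction.  The neighbourhood may depend on the direction. *)
Definition C1_at f x := {for x, continuous f} /\
  forall v, (\forall y \near x, derivable f y v) /\ {for x, continuous ('D_v f)}.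

Lemma continuous_near_eq f g x : (\forall y \near x, f y = g y) ->
  {for x, continuous f} -> {for x, continuous g}.
Proof.
move=> fg; rewrite /prop_for /continuous_at (nbhs_singleton fg) => cf.
by apply: cvg_trans cf; exact: near_eq_cvg.
Qed.

Lemma Ck_on_C1_at (k : nat) (U : set V) f x : open U -> Ck_on k.+1 U f -> U x ->
  C1_at f x.
Proof.
move=> oU fU Ux; split=> [|v].
  by have [+ _] := fU [::] isT; exact.
split.
  near=> y; have [_] := fU [::] isT; apply => //.
  by near: y; exact: open_nbhs_nbhs.
by have [+ _] := fU [:: v] isT; exact.
Unshelve. all: by end_near. Qed.

Lemma C1_at_derivable f x v : C1_at f x -> derivable f x v.
Proof. by move=> [_ /(_ v)[/nbhs_singleton]]. Qed.

Lemma C1_at_cst (c : R) x : C1_at (cst c) x.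
Proof.
split=> [|v]; first exact: cst_continuous.
split; first by near=> y.
rewrite (_ : 'D_v (cst c) = cst 0) ; last first.
  by apply/funext => y; rewrite derive_cst.
exact: cst_continuous.
Unshelve. all: by end_near. Qed.

Lemma C1_atD f g x : C1_at f x -> C1_at g x -> C1_at (f + g) x.
Proof.
move=> [fx f1] [gx g1]; split=> [|v]; first exact: continuousD.
have [df Df] := f1 v; have [dg Dg] := g1 v; split.
  by apply: filterS2 df dg => y; exact: derivableD.
have E : \forall y \near x, 'D_v f y + 'D_v g y = 'D_v (f + g) y.
  by apply: filterS2 df dg => y dfy dgy; rewrite deriveD.
by apply: continuous_near_eq E _; exact: continuousD.
Qed.

Lemma C1_atM f g x : C1_at f x -> C1_at g x -> C1_at (f * g) x.
Proof.
move=> [fx f1] [gx g1]; split=> [|v]; first exact: continuousM.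
have [df Df] := f1 v; have [dg Dg] := g1 v; split.
  by apply: filterS2 df dg => y; exact: derivableM.
have E : \forall y \near x, f y * 'D_v g y + g y * 'D_v f y = 'D_v (f * g) y.
  by apply: filterS2 df dg => y dfy dgy; exact: esym (deriveM dfy dgy).
apply: continuous_near_eq E _.
by apply: continuousD; exact: continuousM.
Qed.

(** The increment of [f] along [h (v + w)] minus that along [h v] is, by the
    mean value theorem, [h] times a derivative in the direction [w] at a nearby
    point; continuity of that derivative gives the limit.  Right limits
    suffice because both sides are known to exist. *)
Lemma derive_addr f x v w : C1_at f x ->
  'D_(v + w) f x = 'D_v f x + 'D_w f x.
Proof.
move=> [_ f1].
have dvw := nbhs_singleton (f1 (v + w)).1.
have dv := nbhs_singleton (f1 v).1.
apply/eqP; rewrite [X in _ == X]addrC -subr_eq; apply/eqP.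
set q := fun h => h^-1 *: (f (h *: (v + w) + x) - f x)
  - h^-1 *: (f (h *: v + x) - f x).
have L : q h @[h --> 0^'+] --> 'D_(v + w) f x - 'D_v f x.
  by apply: cvgB; exact: derivable_cvg_right.
suff Lw : q h @[h --> 0^'+] --> 'D_w f x by exact: (cvg_unique (@Rhausdorff R) L Lw).
apply/cvgrPdist_lt => e e0.
have [df /cvgrPdist_lt/(_ e e0) Df] := f1 w.
have C := near_right_cone _ _ v w (filterI df Df).
near=> h.
have h0 : 0 < h by [].
have Ph s : 0 <= s <= h -> derivable f (s *: w + (h *: v + x)) w /\
    `|'D_w f x - 'D_w f (s *: w + (h *: v + x))| < e.
  by move: s; near: h; exact: C.
have [s sh] := MVT_line f (h *: v + x) w h h0 (fun s sh => (Ph s sh).1).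
rewrite addrA -scalerDr [w + v]addrC => E.
have -> : q h = 'D_w f (s *: w + (h *: v + x)).
  by rewrite /q -scalerBr opprB addrA subrK E [_ *: _]mulrC mulfK ?(lt0r_neq0 h0).
by apply: (Ph s _).2; case/andP: sh => /ltW-> /ltW->.
Unshelve. all: by end_near. Qed.

Lemma deriveE_line f x v : 'D_v f x = derive1 (fun h : R => f (h *: v + x)) 0.
Proof.
rewrite derive1E /derive; congr (lim (_ @ 0^')); apply/funext => h /=.
by rewrite addr0 scale0r add0r [h *: 1]mulr1.
Qed.

Lemma derive_scaler f x v (k : R) : derivable f x v ->
  'D_(k *: v) f x = k * 'D_v f x.
Proof.
move=> /derivable1P; rewrite !deriveE_line => df.
pose g (h : R) := f (h *: v + x); pose m (h : R) := h * k.
have dm : is_derive (0 : R) 1 m k.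
  by apply: is_derive_eq; rewrite scaler0 add0r [_%:A]mulr1.
have dgm : derivable g (m 0) 1 by rewrite /m mul0r; exact: df.
have -> : (fun h : R => f (h *: (k *: v) + x)) = g \o m.
  by apply/funext => h /=; rewrite /g scalerA.
rewrite (@derive1_comp _ m g 0 (@ex_derive _ _ _ _ _ _ _ dm) dgm).
rewrite [in derive1 g _]/m mul0r mulrC; congr (_ * _).
by rewrite derive1E (@derive_val _ _ _ _ _ _ _ dm).
Qed.

End DirectionalDerivatives.

(** * First and second order conditions at a maximum *)

Section MaximumAlongRay.
Context {R : realType} {V : normedModType R}.

Lemma near_right_below (P : set R) : (\forall h \near 0^'+, P h) ->
  \forall h \near 0^'+, forall s, 0 < s <= h -> P s.
Proof.
move=> [e /= e0 eP]; near=> h.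
have he : h < e by near: h; exact: nbhs_right_lt.
move=> s /andP[s0 sh]; apply: eP => //=.
rewrite sub0r normrN gtr0_norm// (le_lt_trans sh he).
Unshelve. all: by end_near. Qed.

Lemma derive_le0_at_max (K : set V) (u : V -> R) x v :
  (\forall h \near 0^'+, K (h *: v + x)) -> derivable u x v ->
  (forall y, K y -> u y <= u x) -> 'D_v u x <= 0.
Proof.
move=> Kv du umax; apply: cvgr_to_le (derivable_cvg_right _ _ _ du) _.
near=> h; rewrite pmulr_rle0 ?invr_gt0// subr_le0; apply: umax.
by near: h.
Unshelve. all: by end_near. Qed.

(** A substitute for the second-derivative test that does not differentiate
    [mu].  If [phi] had a positive derivative at [x], then [phi], hence
    [mu] times the derivative of [u], would be positive on a short segment
    starting at [x]; as [mu >= 0], [u] would increase there. *)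
Lemma derive_flux_le0_at_max (K : set V) (u phi mu : V -> R) x v :
  (\forall h \near 0^'+, K (h *: v + x)) ->
  (\forall y \near x, derivable u y v) -> derivable phi x v -> phi x = 0 ->
  (forall y, K y -> 0 <= mu y) ->
  (forall y, K y -> phi y = mu y * 'D_v u y) ->
  (forall y, K y -> u y <= u x) -> 'D_v phi x <= 0.
Proof.
move=> Kv du dphi phi0 mu0 phiE umax; rewrite leNgt; apply/negP => Dphi.
have phi_gt0 : \forall h \near 0^'+, 0 < phi (h *: v + x).
  have : \forall h \near 0^'+, 0 < h^-1 *: (phi (h *: v + x) - phi x).
    exact: (cvgr_gt _ (derivable_cvg_right _ _ _ dphi)).
  apply: filter_app; near=> h.
  by rewrite phi0 subr0 pmulr_rgt0// invr_gt0.
have Kphi : \forall h \near 0^'+,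
    forall s, 0 < s <= h -> K (s *: v + x) /\ 0 < phi (s *: v + x).
  by apply: near_right_below; exact: filterI.
have [h [Kphih [duh h0]]] :=
  filter_ex (filterI Kphi (filterI (near_right_segment _ _ v du) (nbhs_right_gt 0))).
have [s /andP[s0 sh] uE] := MVT_line _ _ _ _ h0 duh.
have /Kphih[Ks] : 0 < s <= h by rewrite s0 ltW.
rewrite phiE// => Ds_gt0.
have /umax : K (h *: v + x) by apply: (Kphih h _).1; rewrite h0 lexx.
rewrite -subr_le0 uE pmulr_lle0// leNgt => /negP; apply.
by move: Ds_gt0; apply: contraTT; rewrite -!leNgt; exact/mulr_ge0_le0/mu0.
Unshelve. all: by end_near. Qed.

End MaximumAlongRay.

Section EuclideanCalculus.
Context {R : realType} {d : nat}.
Local Notation E := 'rV[R]_d.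
Implicit Types (x y n : E).

Lemma dotC x y : dot x y = dot y x.
Proof. by apply: eq_bigr => i _; rewrite mulrC. Qed.

Lemma dotDl x y n : dot (x + y) n = dot x n + dot y n.
Proof. by rewrite /dot -big_split; apply: eq_bigr => i _; rewrite mxE mulrDl. Qed.

Lemma dotZl (k : R) x y : dot (k *: x) y = k * dot x y.
Proof. by rewrite /dot mulr_sumr; apply: eq_bigr => i _; rewrite mxE mulrA. Qed.

Lemma dotDr x y n : dot n (x + y) = dot n x + dot n y.
Proof. by rewrite dotC dotDl ![dot _ n]dotC. Qed.

Lemma dotZr (k : R) x y : dot x (k *: y) = k * dot x y.
Proof. by rewrite dotC dotZl dotC. Qed.

Lemma dot_ge0 x : 0 <= dot x x.
Proof. by apply: sumr_ge0 => i _; rewrite -expr2 sqr_ge0. Qed.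

Lemma dot_eq0 x : (dot x x == 0) = (x == 0).
Proof.
apply/eqP/eqP => [x0|->]; last by apply: big1 => i _; rewrite mxE mul0r.
apply/rowP => i; rewrite mxE; apply/eqP; rewrite -sqrf_eq0 expr2.
by apply/eqP; apply: (psumr_eq0P _ x0) => // j _; rewrite -expr2 sqr_ge0.
Qed.

Lemma dot_gt0 x : (0 < dot x x) = (x != 0).
Proof. by rewrite lt0r dot_eq0 dot_ge0 andbT. Qed.

Lemma sqr_enorm x : enorm x ^+ 2 = dot x x.
Proof. by rewrite sqr_sqrtr// dot_ge0. Qed.

Lemma derive_grad (f : E -> R) x n : C1_at f x -> 'D_n f x = dot (grad f x) n.
Proof.
move=> f1; rewrite [in LHS](row_sum_delta n).
rewrite (big_morph (fun v => 'D_v f x) (fun v w => derive_addr f x v w f1)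
  (derive0 f x)).
by apply: eq_bigr => i _; rewrite derive_scaler ?mxE 1?mulrC//; exact: C1_at_derivable.
Qed.

(** A quadratic form is even, so a sign on one open half-space is a sign on
    both; a vector [x] of the separating hyperplane is the limit of the
    vectors [x - s n] as [s > 0] tends to zero.  The case [n = 0] stands for
    the whole space. *)
Lemma le0_quadratic_halfspace (M : 'M[R]_d) n :
  (forall x, n = 0 \/ dot n x < 0 -> dot (x *m M) x <= 0) ->
  forall x, dot (x *m M) x <= 0.
Proof.
move=> M0 x; have [n0|n0] := eqVneq n 0; first by apply: M0; left.
have [nx|nx|nx] := ltgtP (dot n x) 0.
- by apply: M0; right.
- have := M0 (-1 *: x); rewrite -scalemxAl dotZl !dotZr !mulN1r opprK.
  by apply; right; rewrite oppr_lt0.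
rewrite leNgt; apply/negP => q0.
set q := dot (x *m M) x in q0.
set b := dot (x *m M) n + dot (n *m M) x; set c := dot (n *m M) n.
have le0 s : 0 < s -> q - s * b + s ^+ 2 * c <= 0.
  move=> s0; have := M0 (x + (- s) *: n).
  have -> : dot ((x + - s *: n) *m M) (x + - s *: n) = q - s * b + s ^+ 2 * c.
    by rewrite mulmxDl -scalemxAl !dotDl !dotDr !dotZl !dotZr /q /b /c; ring.
  by apply; right; rewrite dotDr dotZr nx add0r mulNr oppr_lt0 mulr_gt0 ?dot_gt0.
have m0 : 0 < q + (`|b| + `|c|) by rewrite ltr_wpDr ?addr_ge0.
(* This [s] is small enough that [s b] and [s^2 c] cannot compensate [q]. *)
set s := q / (q + (`|b| + `|c|)); have s0 : 0 < s by exact: divr_gt0.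
have s1 : s <= 1 by rewrite ler_pdivrMr// mul1r lerDl addr_ge0.
have sE : s * (q + (`|b| + `|c|)) = q by rewrite divfK ?gt_eqF.
have sb : s * b <= s * `|b| by rewrite ler_pM2l// ler_norm.
have sc : - (s ^+ 2 * c) <= s * `|c|.
  rewrite -mulrN expr2 -mulrA ler_pM2l// (le_trans (ler_norm _))// normrM normrN.
  by rewrite gtr0_norm// ler_piMl.
have sq : 0 < s * q by exact: mulr_gt0.
have := le0 s s0; lra.
Qed.

(** The vector [n] is an outer normal of [K] at [x], or zero if [x] is
    interior.  The two uses of inward directions are: at first order, moving
    along [grad u - n] shows that the flux vanishes at [x]; at second order, the
    quadratic form of the derivative of the flux is nonpositive on inward
    directions, hence everywhere, hence has nonpositive trace. *)
Lemma div_le0_at_max (K : set E) n (u : E -> R) (G : E -> E) (mu : E -> R) x :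
  (forall v, n = 0 \/ dot n v < 0 -> \forall h \near 0^'+, K (h *: v + x)) ->
  K x -> (forall y, K y -> C1_at u y) ->
  (forall i, C1_at (fun y => G y 0 i) x) ->
  (forall y, K y -> 0 <= mu y) ->
  (forall y, K y -> G y = mu y *: grad u y) -> dot (G x) n = 0 ->
  (forall y, K y -> u y <= u x) -> div G x <= 0.
Proof.
move=> Kn Kx u1 G1 mu0 GE Gn umax.
have Gx0 : G x = 0.
  rewrite GE//; have [->|mux] := eqVneq (mu x) 0; first by rewrite scale0r.
  have gn : dot (grad u x) n = 0.
    by move: Gn; rewrite GE// dotZl => /eqP; rewrite mulf_eq0 (negbTE mux) => /eqP.
  suff : grad u x == 0 by move=> /eqP->; rewrite scaler0.
  rewrite -dot_eq0 eq_le dot_ge0 andbT.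
  suff : dot (grad u x) (grad u x - n) <= 0.
    by rewrite -scaleN1r dotDr dotZr gn mulr0 addr0.
  rewrite -derive_grad; last exact: u1.
  apply: (derive_le0_at_max K) => //; last exact/C1_at_derivable/u1.
  apply: Kn; have [|n0] := eqVneq n 0; [by left|right].
  by rewrite -scaleN1r dotDr dotC gn dotZr mulN1r add0r oppr_lt0 dot_gt0.
pose M : 'M[R]_d := \matrix_(i, j) 'D_(basis_vec i) (fun y => G y 0 j) x.
have M0 v : dot (v *m M) v <= 0.
  move: v; apply: (le0_quadratic_halfspace M n) => v nv.
  pose phi := \sum_(j < d) (v 0 j \*: (fun y => G y 0 j)).
  have dG j : derivable (fun y => G y 0 j) x v by exact: C1_at_derivable.
  have -> : dot (v *m M) v = 'D_v phi x.
    rewrite derive_sum => [|j]; last exact: derivableZ.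
    apply: eq_bigr => j _; rewrite deriveZ// derive_grad// mulrC; congr (_ * _).
    by rewrite !mxE /dot; apply: eq_bigr => i _; rewrite !mxE mulrC.
  have phiE y : phi y = dot (G y) v.
    by rewrite /phi fct_sumE; apply: eq_bigr => j _; rewrite mulrC.
  apply: (derive_flux_le0_at_max K u phi mu) => //.
  - exact: Kn.
  - by have [_ /(_ v)[]] := u1 x Kx.
  - by apply: derivable_sum => j; exact: derivableZ.
  - by rewrite phiE Gx0; apply: big1 => j _; rewrite mxE mul0r.
  - by move=> y Ky; rewrite phiE GE// dotZl derive_grad//; exact: u1.
apply: sumr_le0 => i _; have := M0 (basis_vec i).
rewrite -rowE /dot (bigD1 i)//= big1 => [|j ji]; last first.
  by rewrite mulrC /basis_vec !mxE (negbTE ji) andbF mul0r.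
by rewrite addr0 /basis_vec !mxE !eqxx mulr1.
Qed.

End EuclideanCalculus.

(** * Passing to the closure, and the parabolic maximum principle *)

Section ClosureExtension.
Context {R : realType} {X : topologicalType}.
Implicit Types (A : set X) (f g : X -> R).

Lemma closure_ge0 A f x : closure A x -> {for x, continuous f} ->
  (forall y, A y -> 0 <= f y) -> 0 <= f x.
Proof.
move=> Ax fx f0; rewrite leNgt; apply/negP => fx0.
have [y [Ay]] := Ax _ (cvgr_lt _ fx _ fx0).
by apply/negP; rewrite -leNgt f0.
Qed.

Lemma closure_eq A f g x : closure A x ->
  {for x, continuous f} -> {for x, continuous g} ->
  (forall y, A y -> f y = g y) -> f x = g x.
Proof.
move=> Ax fx gx fg; apply/eqP; rewrite eq_le -subr_ge0 -[X in _ && X]subr_ge0.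
apply/andP; split.
  apply: (closure_ge0 A (g - f)) => //; first exact: continuousB.
  by move=> y Ay; rewrite -[_ y]/(g y - f y) fg// subrr.
apply: (closure_ge0 A (f - g)) => //; first exact: continuousB.
by move=> y Ay; rewrite -[_ y]/(f y - g y) fg// subrr.
Qed.

End ClosureExtension.

Section ParabolicMaximumPrinciple.
Context {R : realType} {X : topologicalType}.

(** At a maximum with [t > 0] of [u - e t] over the closed cylinder, comparison
    with earlier times only gives [u_t >= e]; this is all that is available
    when [t = T]. *)
Lemma le0_of_derive1_le0_at_max (K : set X) (T : R) (u : R -> X -> R) :
  compact K ->
  (forall t x, t \in `[0, T] -> K x ->
     {for (t, x), continuous (fun z : R * X => u z.1 z.2)}) ->
  (forall t x, t \in `[0, T] -> K x -> derivable (u ^~ x) t 1) ->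
  (forall x, K x -> u 0 x <= 0) ->
  (forall t x, t \in `[0, T] -> K x -> (forall y, K y -> u t y <= u t x) ->
     derive1 (u ^~ x) t <= 0) ->
  forall t x, t \in `[0, T] -> K x -> u t x <= 0.
Proof.
move=> cK cu du u0 umax t x tT Kx; rewrite leNgt; apply/negP => utx.
have [t0 tT'] : 0 <= t /\ t <= T by move: tT; rewrite in_itv/= => /andP.
have T0 : 0 <= T by exact: le_trans tT'.
(* The factor 2 keeps [u - e t] positive at the given point, and [T + 1]
   rather than [T] spares the case [T = 0]. *)
pose e := u t x / (2 * (T + 1)).
have e0 : 0 < e by rewrite divr_gt0// mulr_gt0// ltr_wpDl.
have eT : e * (2 * (T + 1)) = u t x by rewrite divfK// gt_eqF// mulr_gt0// ltr_wpDl.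
pose w (z : R * X) := u z.1 z.2 - e * z.1.
have cQ : compact (`[0, T]%classic `*` K).
  by apply: compact_setX => //; exact: segment_compact.
have [||[s y]] := @compact_EVT_max _ _ w _ _ cQ.
- by exists (t, x); split.
- apply: continuous_in_subspaceT => z; rewrite inE => -[zT Kz].
  have cu1 : {for z, continuous (fun z : R * X => u z.1 z.2)}.
    by case: z zT Kz => s y sT Ky; exact: cu.
  have ct : {for z, continuous (fun z : R * X => e * z.1)}.
    by apply: continuousM; [exact: cst_continuous|exact: cvg_fst].
  exact: continuousB cu1 ct.
rewrite inE => -[/= sT Ky] wmax.
have wle s' y' : s' \in `[0, T] -> K y' -> u s' y' - e * s' <= u s y - e * s.
  by move=> s'T Ky'; have := wmax (s', y'); apply; rewrite inE; split.
have usy : 0 < u s y - e * s.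
  apply: lt_le_trans (wle t x tT Kx).
  have : e * t <= e * T by rewrite ler_pM2l.
  lra.
have [s0 sT'] : 0 <= s /\ s <= T by move: sT; rewrite /= in_itv/= => /andP.
move: s0; rewrite le_eqVlt => /orP[/eqP s0|s0].
  by move: usy; rewrite -s0 mulr0 subr0 ltNge u0.
have D0 : derive1 (u ^~ y) s <= 0.
  by apply: umax => // y' Ky'; have := wle s y' sT Ky'; rewrite lerD2r.
have dsy : derivable (u ^~ y) s 1 by exact: du.
have de : derivable (e \*: (id : R -> R)) s 1 := derivableZ (@derivable_id _ _ s 1).
pose g := (u ^~ y) - e \*: (id : R -> R).
have dg : derivable g s 1 := derivableB dsy de.
have : 'D_(-1 *: 1) g s <= 0.
  apply: (derive_le0_at_max `[0, T]%classic).
  - near=> h; rewrite /= in_itv/= scaleN1r scalerN [h *: 1]mulr1 addrC.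
    rewrite subr_ge0 ltW/=; last by near: h; exact: nbhs_right_lt.
    by rewrite (le_trans _ sT')// gerBl.
  - exact/diff_derivable/derivable1_diffP.
  - by move=> s' s'T; apply: wle.
rewrite (derive_scaler _ _ _ _ dg) mulN1r oppr_le0 (deriveB dsy de).
rewrite (deriveZ _ (@derivable_id _ _ s 1)) derive_id -derive1E [_ *: _]mulr1.
lra.
Unshelve. all: by end_near. Qed.

End ParabolicMaximumPrinciple.

(** * Inward directions of a smooth domain *)

Section SmoothDomains.
Context {R : realType} {d : nat}.
Local Notation E := 'rV[R]_d.

(** At a boundary point the defining function is nonpositive, by continuity,
    and decreases strictly along a direction that makes an obtuse angle with
    its gradient, so the domain contains the beginning of the corresponding
    segment. *)
Lemma smooth_domain_inward (Omega : set E) x :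
  smooth_bounded_domain Omega -> closure Omega x ->
  exists n, (forall v, n = 0 \/ dot n v < 0 ->
                \forall h \near 0^'+, Omega (h *: v + x)) /\
            (n = 0 \/ boundary Omega x /\ outer_unit_normal Omega x n).
Proof.
move=> [oO _ _ _ bO] cx; have [Ox|nOx] := pselect (Omega x).
  exists 0; split; last by left.
  move=> v _; have := near_right_segment _ _ v (open_nbhs_nbhs (conj oO Ox)).
  by move=> C; near=> h; have := near C h; apply=> //; rewrite lexx andbT ltW.
have bx : boundary Omega x by split=> //; rewrite ((interior_id _).1 oO).
have [U [rho ldf]] := bO x bx; have [[oU Ux] srho grho Orho] := ldf.
have rho1 y : U y -> C1_at rho y by exact: (Ck_on_C1_at 0 U).
have g0 : 0 < enorm (grad rho x) by rewrite sqrtr_gt0 dot_gt0 grho.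
exists ((enorm (grad rho x))^-1 *: grad rho x); split; last first.
  by right; split => //; exists U, rho.
move=> v [/eqP|].
  by rewrite scaler_eq0 invr_eq0 gt_eqF//= (negbTE (grho _ Ux)).
rewrite dotZl pmulr_rlt0 ?invr_gt0// -derive_grad; last exact: rho1.
move=> Dv; have rx : rho x <= 0.
  rewrite leNgt; apply/negP => rx.
  have [y [Oy [Uy ry]]] := cx _ (filterI (open_nbhs_nbhs (conj oU Ux))
    (cvgr_gt _ (rho1 x Ux).1 _ rx)).
  by have := (Orho y Uy).1 Oy; apply/negP; rewrite -leNgt ltW.
have dr : derivable rho x v by exact/C1_at_derivable/rho1.
have C1 : \forall h \near 0^'+, h^-1 * (rho (h *: v + x) - rho x) < 0.
  exact: (cvgr_lt _ (derivable_cvg_right _ _ _ dr)).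
have C2 := near_right_segment _ _ v (open_nbhs_nbhs (conj oU Ux)).
near=> h; have h0 : 0 < h by [].
have Uh : U (h *: v + x).
  by have := near C2 h; apply=> //; rewrite lexx andbT ltW.
apply/(Orho _ Uh); apply: lt_le_trans rx.
by have := near C1 h; rewrite pmulr_rlt0 ?invr_gt0// subr_lt0; apply.
Unshelve. all: by end_near. Qed.

End SmoothDomains.

(** * The differential inequality for the quadratic combination *)

Section Slices.
Context {R : realType} {V : normedModType R}.
Variables (f : R -> V -> R) (t : R).
Let F (z : R * V) := f z.1 z.2.

Let continuous_slice (g : R * V -> R) x :
  {for (t, x), continuous g} -> {for x, continuous (fun y => g (t, y))}.
Proof.
apply: (@continuous_comp _ _ _ (fun y : V => (t, y)) g).
exact: (cvg_pair (cvg_cst t) cvg_id).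
Qed.

Let space_quotient y v :
  (fun h : R => h^-1 *: ((F \o shift (t, y)) (h *: (0, v)) - F (t, y))) =
  (fun h => h^-1 *: ((f t \o shift y) (h *: v) - f t y)).
Proof. by apply/funext => h; rewrite /F /= scaler0 add0r. Qed.

Let time_quotient y :
  (fun h : R => h^-1 *: ((F \o shift (t, y)) (h *: (1, 0)) - F (t, y))) =
  (fun h => h^-1 *: ((f ^~ y \o shift t) (h *: 1) - f t y)).
Proof. by apply/funext => h; rewrite /F /= scaler0 add0r. Qed.

Lemma C1_at_space_slice x : C1_at F (t, x) -> C1_at (f t) x.
Proof.
move=> [cF F1]; split; first exact: continuous_slice cF.
move=> v; have [dF DF] := F1 (0, v); split.
  have c : {for x, continuous (fun y : V => (t, y))}.
    exact: (cvg_pair (cvg_cst t) cvg_id).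
  apply: (@filterS _ (nbhs x) _ _ _ _ (c _ dF)) => y.
  by rewrite /= /derivable space_quotient.
have -> : 'D_v (f t) = fun y => 'D_(0, v) F (t, y).
  by apply/funext => y; rewrite /derive space_quotient.
exact: continuous_slice DF.
Qed.

Lemma C1_at_time_derivable x : C1_at F (t, x) -> derivable (f ^~ x) t 1.
Proof.
by move=> F1; have := C1_at_derivable F _ (1, 0) F1; rewrite /derivable time_quotient.
Qed.

Lemma C1_at_continuous_derive1 x : C1_at F (t, x) ->
  {for x, continuous (fun y => derive1 (f ^~ y) t)}.
Proof.
move=> [_ /(_ (1, 0))[_ DF]].
have -> : (fun y => derive1 (f ^~ y) t) = fun y => 'D_(1, 0) F (t, y).
  by apply/funext => y; rewrite derive1E /derive time_quotient.
exact: continuous_slice DF.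
Qed.

End Slices.

Section QuadraticCombination.
Context {R : realType} {V : normedModType R}.
Variables (a b c : R) (p q g k : V -> R) (x v : V).
Hypotheses (dp : derivable p x v) (dq : derivable q x v).
Hypotheses (dg : derivable g x v) (dk : derivable k x v).

Lemma derive_quadratic :
  'D_v (fun y => a * p y + b * (p y * p y) + c * q y) x =
  (a + 2 * b * p x) * 'D_v p x + c * 'D_v q x.
Proof.
have -> : (fun y => a * p y + b * (p y * p y) + c * q y) =
    a \*: p + b \*: (p * p) + c \*: q by [].
have dpp := derivableM dp dp.
rewrite (deriveD (derivableD (derivableZ dp) (derivableZ dpp)) (derivableZ dq)).
rewrite (deriveD (derivableZ dp) (derivableZ dpp)).
rewrite (deriveZ a dp) (deriveZ b dpp) (deriveZ c dq) (deriveM dp dp).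
rewrite /GRing.scale /=; ring.
Qed.

Lemma derive_quadratic_flux :
  'D_v (fun y => (a + 2 * b * p y) * g y + c * k y) x =
  (a + 2 * b * p x) * 'D_v g x + 2 * b * (g x * 'D_v p x) + c * 'D_v k x.
Proof.
have -> : (fun y => (a + 2 * b * p y) * g y + c * k y) =
    (cst a + (2 * b) \*: p) * g + c \*: k by [].
have dm := derivableD (derivable_cst a x v) (@derivableZ _ _ _ _ (2 * b) _ _ dp).
rewrite (deriveD (derivableM dm dg) (derivableZ dk)) (deriveM dm dg).
rewrite (deriveD (derivable_cst a x v) (derivableZ dp)) derive_cst.
rewrite (deriveZ _ dp) (deriveZ c dk).
rewrite (_ : (cst a + _) x = a + 2 * b * p x)// /GRing.scale /=; ring.
Qed.

End QuadraticCombination.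

Lemma continuous_sum_at (R : realType) (X : topologicalType) (d : nat)
    (f : 'I_d -> X -> R) x :
  (forall i, {for x, continuous (f i)}) ->
  {for x, continuous (fun y => \sum_i f i y)}.
Proof.
move=> cf; have -> : (fun y => \sum_i f i y) = \sum_i f i.
  by apply/funext => y; rewrite fct_sumE.
elim/big_ind: _ => //; first exact: cst_continuous.
by move=> g h cg ch; exact: continuousD.
Qed.

Lemma smooth_near_C1_at (R : realType) (V : normedModType R) (A : set V)
  (f : V -> R) x : smooth_near A f -> A x -> C1_at f x.
Proof.
by move=> [U [oU AU fU]] Ax; apply: (Ck_on_C1_at 0 U f x oU (fU _)); exact: AU.
Qed.

(** One family of extensions for all the components; every property of the
    flux used on the closed set is read off it. *)
Lemma flux_extension (R : realType) (d : nat) (A : set 'rV[R]_d)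
    (F : 'rV[R]_d -> 'rV[R]_d) :
  (forall i, Ck_upto 1 A (fun x => F x 0 i)) ->
  exists g : 'I_d -> 'rV[R]_d -> R,
    (forall i x, A x -> C1_at (g i) x) /\ (forall i x, A x -> F x 0 i = g i x).
Proof.
move=> /choice[g gP]; exists g; split=> i x Ax; have [U [oU AU gU Fg]] := gP i.
  by apply: (Ck_on_C1_at 0 U _ _ oU gU); exact: AU.
by apply: Fg; exact: mem_set.
Qed.

Lemma div_extension (R : realType) (d : nat) (O : set 'rV[R]_d)
    (F : 'rV[R]_d -> 'rV[R]_d) (g : 'I_d -> 'rV[R]_d -> R) x :
  open O -> (forall i y, O y -> F y 0 i = g i y) -> O x ->
  div F x = \sum_i 'D_(basis_vec i) (g i) x.
Proof.
move=> oO Fg Ox; apply: eq_bigr => i _; apply: near_eq_derive.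
have := open_nbhs_nbhs (conj oO Ox); apply: filterS => y Oy; exact: Fg.
Qed.

Section InvariantRegion.
Context {R : realType} {d : nat}.
Variables (Omega : set 'rV[R]_d) (eta kappa : R -> R).
Hypothesis hOmega : smooth_bounded_domain Omega.
Hypothesis eta_ge0 : forall s, 0 <= s -> 0 <= eta s.
Hypothesis eta_eq_kappa : forall s, 0 <= s -> eta s = kappa s.
Variables (T : R) (v w : R -> 'rV[R]_d -> R) (v0 w0 : 'rV[R]_d -> R).
Hypothesis w_ge0 : forall t x, t \in `[0, T] -> Omega x -> 0 <= w t x.
Hypothesis hvw : classical_solution eta kappa T Omega v w v0 w0.
Local Notation K := (closure Omega).

Let V1 t x : t \in `[0, T] -> K x -> C1_at (fun z : R * 'rV[R]_d => v z.1 z.2) (t, x).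
Proof. by move=> tT Kx; apply: smooth_near_C1_at (cs_smooth_v hvw) _; split. Qed.

Let W1 t x : t \in `[0, T] -> K x -> C1_at (fun z : R * 'rV[R]_d => w z.1 z.2) (t, x).
Proof. by move=> tT Kx; apply: smooth_near_C1_at (cs_smooth_w hvw) _; split. Qed.

Let v1 t x : t \in `[0, T] -> K x -> C1_at (v t) x.
Proof. by move=> tT Kx; exact/C1_at_space_slice/V1. Qed.

Let w1 t x : t \in `[0, T] -> K x -> C1_at (w t) x.
Proof. by move=> tT Kx; exact/C1_at_space_slice/W1. Qed.

Let w_ge0K t x : t \in `[0, T] -> K x -> 0 <= w t x.
Proof.
move=> tT Kx; apply: (closure_ge0 _ (w t) _ Kx); first exact: (w1 _ _ tT Kx).1.
by move=> y; exact: w_ge0.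
Qed.

(** Both sides of each equation are continuous on the closed domain once the
    fluxes are replaced by their extensions.  The source term is written with
    the flux [g] because [eta (w t x)] need not be continuous in [x]. *)
Lemma equations_on_closure t x (g h : 'I_d -> 'rV[R]_d -> R) :
  t \in `[0, T] -> K x ->
  (forall i y, K y -> C1_at (g i) y) -> (forall i y, K y -> C1_at (h i) y) ->
  (forall i y, K y -> flux eta w v t y 0 i = g i y) ->
  (forall i y, K y -> flux kappa w w t y 0 i = h i y) ->
  derive1 (v ^~ x) t = \sum_i 'D_(basis_vec i) (g i) x /\
  derive1 (w ^~ x) t = \sum_i 'D_(basis_vec i) (h i) x +
                       \sum_i g i x * 'D_(basis_vec i) (v t) x.
Proof.
move=> tT Kx g1 h1 gE hE.
have oO : open Omega by have [] := hOmega.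
have OK y : Omega y -> K y by exact: subset_closure.
have cdiv (k : 'I_d -> 'rV[R]_d -> R) : (forall i y, K y -> C1_at (k i) y) ->
    {for x, continuous (fun y => \sum_i 'D_(basis_vec i) (k i) y)}.
  move=> k1; apply: continuous_sum_at => i.
  by have [_ /(_ (basis_vec i))[]] := k1 i x Kx.
have cgrad : {for x, continuous
    (fun y => \sum_i g i y * 'D_(basis_vec i) (v t) y)}.
  apply: continuous_sum_at => i; apply: continuousM; first exact: (g1 i x Kx).1.
  by have [_ /(_ (basis_vec i))[]] := v1 _ _ tT Kx.
split.
  apply: (closure_eq Omega (fun y => derive1 (v ^~ y) t)
    (fun y => \sum_i 'D_(basis_vec i) (g i) y)) => //.
  - exact: (C1_at_continuous_derive1 v t x (V1 _ _ tT Kx)).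
  - exact: cdiv.
  move=> y Oy; rewrite (cs_eq_v hvw tT Oy).
  by apply: (div_extension _ _ Omega) => // i z /OK; exact: gE.
apply: (closure_eq Omega (fun y => derive1 (w ^~ y) t)
    (fun y => \sum_i 'D_(basis_vec i) (h i) y +
              \sum_i g i y * 'D_(basis_vec i) (v t) y)) => //.
- exact: (C1_at_continuous_derive1 w t x (W1 _ _ tT Kx)).
- exact: continuousD (cdiv _ h1) cgrad.
move=> y Oy; rewrite (cs_eq_w hvw tT Oy); congr (_ + _).
  by apply: (div_extension _ _ Omega) => // i z /OK; exact: hE.
rewrite sqr_enorm /dot mulr_sumr; apply: eq_bigr => i _.
by rewrite -(gE i y (OK _ Oy)) !mxE mulrA.
Qed.

Lemma invariant_region (a b c : R) : c <= 2 * b ->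
  (forall x, Omega x -> a * v0 x + b * v0 x ^+ 2 + c * w0 x <= 0) ->
  forall t x, t \in `[0, T] -> Omega x ->
    a * v t x + b * v t x ^+ 2 + c * w t x <= 0.
Proof.
move=> cb init t x tT Ox; rewrite expr2.
have KO y : Omega y -> K y by exact: subset_closure.
pose u t x := a * v t x + b * (v t x * v t x) + c * w t x.
suff : u t x <= 0 by [].
have T0 : 0 \in `[0, T].
  by move: tT; rewrite !in_itv/= lexx => /andP[]; exact: le_trans.
have cK : compact K.
  apply: bounded_closed_compact; last exact: closed_closure.
  have [_ _ _ [M [Mreal OM]] _] := hOmega; exists M; split=> // m Mm y Ky.
  rewrite /= -subr_ge0; apply: (closure_ge0 Omega (fun z => m - `|z|)) => //.
    by apply: continuousB; [exact: cst_continuous|exact: norm_continuous].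
  by move=> z Oz; rewrite subr_ge0; exact: OM.
have U1 s y : s \in `[0, T] -> K y ->
    C1_at (fun z : R * 'rV[R]_d => u z.1 z.2) (s, y).
  move=> sT Ky.
  have := C1_atD _ _ _ (C1_atD _ _ _
    (C1_atM _ _ _ (C1_at_cst a _) (V1 _ _ sT Ky))
    (C1_atM _ _ _ (C1_at_cst b _) (C1_atM _ _ _ (V1 _ _ sT Ky) (V1 _ _ sT Ky))))
    (C1_atM _ _ _ (C1_at_cst c _) (W1 _ _ sT Ky)).
  exact.
move: t x tT {Ox}(KO x Ox).
apply: (le0_of_derive1_le0_at_max K T u cK).
- by move=> s y sT Ky; exact: (U1 _ _ sT Ky).1.
- by move=> s y sT Ky; exact/C1_at_time_derivable/U1.
- move=> y Ky; rewrite -oppr_ge0; apply: (closure_ge0 Omega (fun z => - u 0 z)) => //.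
    apply: continuousN; exact: (C1_at_space_slice u 0 y (U1 _ _ T0 Ky)).1.
  move=> z Oz; rewrite oppr_ge0 /u (cs_init_v hvw Oz) (cs_init_w hvw Oz) -expr2.
  exact: init.
move=> t x tT Kx umax.
have [g [g1 gE]] := flux_extension _ _ _ _ (cs_flux_v hvw tT).
have [h [h1 hE]] := flux_extension _ _ _ _ (cs_flux_w hvw tT).
have [eqv eqw] := equations_on_closure t x g h tT Kx g1 h1 gE hE.
have dvt : derivable (v ^~ x) t 1 by exact/C1_at_time_derivable/V1.
have dwt : derivable (w ^~ x) t 1 by exact/C1_at_time_derivable/W1.
pose G y : 'rV[R]_d := \row_i ((a + 2 * b * v t y) * g i y + c * h i y).
have vx1 := v1 _ _ tT Kx.
have divGE : div G x = (a + 2 * b * v t x) * (\sum_i 'D_(basis_vec i) (g i) x)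
    + 2 * b * (\sum_i g i x * 'D_(basis_vec i) (v t) x)
    + c * (\sum_i 'D_(basis_vec i) (h i) x).
  rewrite !mulr_sumr -!big_split; apply: eq_bigr => i _ /=.
  rewrite (_ : (fun y => G y 0 i) =
    fun y => (a + 2 * b * v t y) * g i y + c * h i y); last first.
    by apply/funext => y; rewrite mxE.
  exact: (derive_quadratic_flux a b c _ _ _ _ _ (C1_at_derivable _ _ _ vx1)
    (C1_at_derivable _ _ _ (g1 i x Kx)) (C1_at_derivable _ _ _ (h1 i x Kx))).
have Egrad y : K y -> grad (u t) y =
    (a + 2 * b * v t y) *: grad (v t) y + c *: grad (w t) y.
  move=> Ky; apply/rowP => i; rewrite !mxE.
  by apply: derive_quadratic; apply: C1_at_derivable; [exact: v1|exact: w1].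
have GE y : K y ->
    G y = (a + 2 * b * v t y) *: flux eta w v t y + c *: flux kappa w w t y.
  by move=> Ky; apply/rowP => i; rewrite [LHS]mxE -gE// -hE// !mxE.
(* The normal used at [x], which is zero in the interior. *)
have [n [Kn nP]] := smooth_domain_inward Omega x hOmega Kx.
have divG : div G x <= 0.
  apply: (div_le0_at_max K n (u t) G (fun y => eta (w t y)) x _ Kx _ _ _ _ _ umax).
  - by move=> e /Kn; apply: filterS => r; exact: KO.
  - by move=> y Ky; exact/C1_at_space_slice/U1.
  - move=> i; rewrite (_ : (fun y => G y 0 i) =
        (cst a + cst (2 * b) * v t) * g i + cst c * h i); last first.
      by apply/funext => y; rewrite mxE.
    have C1a := C1_atD _ _ _ (C1_at_cst a x) (C1_atM _ _ _ (C1_at_cst (2 * b) x) vx1).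
    exact: (C1_atD _ _ _ (C1_atM _ _ _ C1a (g1 i x Kx))
      (C1_atM _ _ _ (C1_at_cst c x) (h1 i x Kx))).
  - by move=> y Ky; exact/eta_ge0/w_ge0K.
  - move=> y Ky; rewrite GE// Egrad// /flux -eta_eq_kappa; last exact: w_ge0K.
    by rewrite scalerDr !scalerA; congr (_ *: _ + _ *: _); rewrite mulrC.
  - case: nP => [->|[bx nx]].
      by rewrite dotC; apply: big1 => i _; rewrite mxE mul0r.
    rewrite GE// dotDl 2!(dotZl _ (flux _ _ _ _ _)) (cs_bc_v hvw tT bx nx).
    rewrite (cs_bc_w hvw tT bx nx).
    by rewrite !mulr0 addr0.
(* Entropy production, with the sign that [c <= 2 b] makes favourable. *)
have dissip : 0 <= \sum_i g i x * 'D_(basis_vec i) (v t) x.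
  apply: sumr_ge0 => i _; rewrite -gE// !mxE -mulrA mulr_ge0//.
    exact/eta_ge0/w_ge0K.
  by rewrite -expr2 sqr_ge0.
rewrite derive1E (derive_quadratic a b c _ _ _ _ dvt dwt) -!derive1E eqv eqw.
have : 0 <= (2 * b - c) * \sum_i g i x * 'D_(basis_vec i) (v t) x.
  by rewrite mulr_ge0// subr_ge0.
move: divG; rewrite divGE; lra.
Qed.

End InvariantRegion.

(** For the second claim, [v - M w] and [- v - M w] are both of the form
    treated, with [b = 0] and [c = - M]. *)
Theorem proposition5p4 (R : realType) (d : nat) (hd : (0 < d)%N)
  (Omega : set 'rV[R]_d) (hOmega : smooth_bounded_domain Omega)
  (eta kappa : R -> R)
  (eta_ge0 : forall s, 0 <= s -> 0 <= eta s)
  (kappa_ge0 : forall s, 0 <= s -> 0 <= kappa s)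
  (eta_eq_kappa : forall s, 0 <= s -> eta s = kappa s)
  (T : R) (v w : R -> 'rV[R]_d -> R) (v0 w0 : 'rV[R]_d -> R)
  (w_ge0 : forall t x, t \in `[0, T] -> Omega x -> 0 <= w t x)
  (hvw : classical_solution eta kappa T Omega v w v0 w0) :
  (forall a b c : R, c <= 2 * b ->
     (forall x, Omega x -> a * v0 x + b * v0 x ^+ 2 + c * w0 x <= 0) ->
     forall t x, t \in `[0, T] -> Omega x ->
       a * v t x + b * v t x ^+ 2 + c * w t x <= 0) /\
  (forall M : R, 0 <= M ->
     (forall x, Omega x -> `|v0 x| <= M * w0 x) ->
     forall t x, t \in `[0, T] -> Omega x -> `|v t x| <= M * w t x).
Proof.
have region := invariant_region Omega eta kappa hOmega eta_ge0 eta_eq_kappa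
  T v w v0 w0 w_ge0 hvw.
split=> // M M0 init t x tT Ox.
have c0 : - M <= 2 * 0 by rewrite mulr0 oppr_le0.
rewrite ler_norml; apply/andP; split.
- have := region (-1) 0 (- M) c0 _ t x tT Ox.
  rewrite mul0r addr0 mulN1r mulNr => H; rewrite lerNl -subr_le0; apply: H => y Oy.
  rewrite mul0r addr0 mulN1r mulNr subr_le0 lerNl.
  by have := init y Oy; rewrite ler_norml => /andP[].
- have := region 1 0 (- M) c0 _ t x tT Ox.
  rewrite mul0r addr0 mul1r mulNr subr_le0; apply=> y Oy.
  by rewrite mul0r addr0 mul1r mulNr subr_le0 (le_trans (ler_norm _))// init.
Qed.
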